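(* Let $\alpha\in(0,1)$ and let $n\ge3$. In a network of $n$ firms, the minimum possible value of any coefficient in the influence vector is $\frac{\alpha}{n}$. That is, for every input-output linkage matrix $W$ of $n$ firms and every $i\in\{1,\dots,n\}$ the $i$-th coordinate of $v_W$ is at least $\frac{\alpha}{n}$, and there exist such $W$ and $i$ for which equality holds.
   Context: An input-output linkage matrix of $n$ firms is a real $n\times n$ matrix $W=(w_{ij})$ with $w_{ij}\ge 0$, $w_{ii}=0$ and $\sum_{j=1}^n w_{ij}=1$ for all $i$. With $W'$ the transpose of $W$ and $\vec{\mathbf 1}$ the all-ones column vector, the influence vector of $W$ (for the parameter $\alpha\in(0,1)$) is $v_W=\frac{\alpha}{n}(I-(1-\alpha)W')^{-1}\vec{\mathbf 1}$ (the inverse exists). *)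

(* Defs.v *)
From HB Require Import structures.
From mathcomp Require Import all_boot all_order all_algebra.
From mathcomp Require Import reals.

Set Implicit Arguments.
Unset Strict Implicit.
Unset Printing Implicit Defensive.

Import Order.TTheory GRing.Theory Num.Theory.
Local Open Scope ring_scope.

Definition linkage_matrix (R : realType) (n : nat) (W : 'M[R]_n) : Prop :=
  [/\ forall i j, 0 <= W i j,
      forall i, W i i = 0
    & forall i, \sum_(j < n) W i j = 1].

Definition influence_vector (R : realType) (n : nat) (alpha : R)
    (W : 'M[R]_n) : 'cV[R]_n :=
  (alpha / n%:R) *: (invmx (1%:M - (1 - alpha) *: W^T) *m const_mx 1).

(* [invmx] is the identity on singular matrices, so [influence_vector] is
   meaningful only because of the following fact. *)
Lemma influence_unitmx (R : realType) (n : nat) (alpha : R) (W : 'M[R]_n) :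
  0 < alpha -> alpha < 1 -> linkage_matrix W ->
  1%:M - (1 - alpha) *: W^T \in unitmx.
Proof.
move=> a0 a1 [W0 _ W1]; rewrite -row_free_unit -kermx_eq0.
apply/eqP/row_matrixP => k; rewrite row0.
set u := row k _.
have : u *m (1%:M - (1 - alpha) *: W^T) = 0.
  by apply/sub_kermxP; apply: row_sub.
move: u => u; rewrite mulmxBr mulmx1 -scalemxAr => /eqP.
rewrite subr_eq0 => /eqP hu.
apply/rowP => j; rewrite mxE.
case: (@arg_maxP _ _ _ j xpredT (fun i => `|u 0 i|)) => // m _ hm.
have um : `|u 0 m| <= (1 - alpha) * `|u 0 m|.
  rewrite {1}hu !mxE normrM ger0_norm ?subr_ge0 ?(ltW a1) //.
  rewrite ler_wpM2l ?subr_ge0 ?(ltW a1) //.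
  apply: (le_trans (ler_norm_sum _ _ _)).
  rewrite -[leRHS]mulr1 -(W1 m) mulr_sumr; apply: ler_sum => i _.
  by rewrite mxE normrM (ger0_norm (W0 _ _)) ler_wpM2r //; apply: hm.
have um0 : `|u 0 m| <= 0.
  by move: um; rewrite mulrBl mul1r lerBrDr gerDl pmulr_rle0.
by apply/eqP; rewrite -normr_le0; apply: le_trans (hm j isT) um0.
Qed.

(* Main.v *)
(* The vector [x := (n / alpha) v_W] is the solution of
   [x = 1 + (1 - alpha) W' x].  Summing the negative parts of both sides over
   all firms, and using that the rows of [W] sum to 1, the total negative part
   of [x] is at most [1 - alpha] times itself, hence zero; so [x >= 0], and the
   equation then gives [x >= 1].  Equality holds at any firm from which nobody
   buys, i.e. at a zero column of [W]; such a column exists as soon as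
   [n >= 3]. *)
Require Import Defs.
From mathcomp Require Import all_boot all_order all_algebra.
From mathcomp Require Import reals.

Import Order.TTheory GRing.Theory Num.Theory.
Local Open Scope ring_scope.

Lemma leontief_fixpoint (R : realType) (n : nat) (alpha : R) (W : 'M[R]_n)
    (x := invmx (1%:M - (1 - alpha) *: W^T) *m const_mx 1 : 'cV[R]_n) :
  0 < alpha -> alpha < 1 -> linkage_matrix W ->
  forall i, x i 0 = 1 + (1 - alpha) * \sum_j W j i * x j 0.
Proof.
move=> a0 a1 hW i.
have /matrixP/(_ i 0) : (1%:M - (1 - alpha) *: W^T) *m x = const_mx 1.
  by rewrite /x mulmxA mulmxV ?mul1mx // influence_unitmx.
rewrite mulmxBl mul1mx -scalemxAl !mxE => /eqP.
rewrite subr_eq => /eqP ->; congr (_ + _ * _).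
by apply: eq_bigr => j _; rewrite mxE.
Qed.

(** Stated for supersolutions, so that the constant term 1 of the influence equation can simply be
    dropped. *)
Lemma substochastic_fixpoint_ge0 (R : realDomainType) (n : nat) (b : R)
    (W : 'M[R]_n) (x : 'I_n -> R) :
  0 <= b < 1 -> (forall i j, 0 <= W i j) ->
  (forall i, \sum_j W i j = 1) ->
  (forall i, b * \sum_j W j i * x j <= x i) ->
  forall i, 0 <= x i.
Proof.
move=> /andP[b0 b1] W0 W1 hx.
pose p i := Num.max 0 (- x i).
have p0 i : 0 <= p i by rewrite le_max lexx.
(* Both arguments of the max defining [p i] lie below the bound: 0 because every term is
   nonnegative, [- x i] by [hx] and [- x j <= p j]. *)
have ple i : p i <= b * \sum_j W j i * p j.
  rewrite {1}/p ge_max; apply/andP; split.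
    by rewrite mulr_ge0 // sumr_ge0 // => j _; rewrite mulr_ge0.
  apply: le_trans (_ : - (b * \sum_j W j i * x j) <= _); first by rewrite lerN2.
  rewrite -mulrN -sumrN ler_wpM2l //; apply: ler_sum => j _.
  by rewrite -mulrN ler_wpM2l // le_max lexx orbT.
(* Once the sums are exchanged, each [p j] is weighted by the sum of row [j] of [W], which is 1. *)
have sum_ple : \sum_i p i <= b * \sum_i p i.
  apply: le_trans (ler_sum _ (fun i _ => ple i)) _.
  rewrite -mulr_sumr exchange_big /= ler_wpM2l //.
  by apply: ler_sum => j _; rewrite -mulr_suml W1 mul1r.
have sum_p0 : \sum_i p i = 0.
  apply/le_anti/andP; split; last exact: sumr_ge0.
  rewrite -(pmulr_rle0 _ (_ : 0 < 1 - b)) ?subr_gt0 //.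
  by rewrite mulrBl mul1r subr_le0.
move=> i; have /eqP : p i = 0.
  by apply: (psumr_eq0P _ sum_p0).
by rewrite eq_le ge_max oppr_le0 => /andP[/andP[]].
Qed.

Lemma exists_linkage_matrix_col0 (R : realType) (n : nat) :
  (3 <= n)%N -> exists (W : 'M[R]_n) (i : 'I_n),
  linkage_matrix W /\ forall j, W j i = 0.
Proof.
case: n => [|[|[|n]]] // _.
(* Firm 0 buys only from firm 1, and every other firm only from firm 0. No firm buys from itself,
   and none buys from the last firm, whose index is at least 2. *)
pose f (i : 'I_n.+3) : 'I_n.+3 := if i == 0 then 1 else 0.
have f_neq i : (i == f i) = false by rewrite /f; case: (i =P 0) => [->|/eqP/negbTE].
exists (\matrix_(i, j) (j == f i)%:R), ord_max; split=> [|j]; last first.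
  by rewrite mxE /f; case: ifP.
split=> [i j|i|i]; rewrite ?mxE ?f_neq //.
under eq_bigr do rewrite mxE.
by rewrite (bigD1 (f i)) //= eqxx big1 ?addr0 // => j /negbTE ->.
Qed.

Theorem theorem4p2 (R : realType) (n : nat) (alpha : R)
    (hn : (3 <= n)%N) (ha0 : 0 < alpha) (ha1 : alpha < 1) :
  (forall W : 'M[R]_n, linkage_matrix W ->
     forall i : 'I_n, alpha / n%:R <= influence_vector alpha W i 0) /\
  (exists (W : 'M[R]_n) (i : 'I_n),
     linkage_matrix W /\ influence_vector alpha W i 0 = alpha / n%:R).
Proof.
split=> [W hW i|].
  have fixx := leontief_fixpoint R n alpha W ha0 ha1 hW.
  have [W0 _ W1] := hW.
  rewrite /influence_vector mxE; move: fixx; set x := invmx _ *m _ => fixx.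
  have b0 : 0 <= 1 - alpha by rewrite subr_ge0 ltW.
  have x0 : forall j, 0 <= x j 0.
    apply: (substochastic_fixpoint_ge0 R n (1 - alpha) W) => // [|j].
      by rewrite b0 gtrBl.
    by rewrite [leRHS]fixx lerDr.
  (* After dividing out [alpha / n%:R], it remains to see [1 <= x i 0]. *)
  rewrite ler_peMr ?divr_ge0 ?ler0n ?(ltW ha0) // fixx lerDl mulr_ge0 //.
  by rewrite sumr_ge0 // => j _; rewrite mulr_ge0.
have [W [i [hW Wi0]]] := exists_linkage_matrix_col0 R n hn.
exists W, i; split=> //.
rewrite /influence_vector mxE leontief_fixpoint // big1 ?mulr0 ?addr0 ?mulr1 //.
by move=> j _; rewrite Wi0 mul0r.
Qed.
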